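(* Let $X$, $Y$, $E$ be sets, let $\mathcal{H}$ be a family of mappings from $X$ to $Y$, let $G$ be a Banach space over $\mathbb{R}$ or $\mathbb{C}$, and let $K$ be a nonempty compact Hausdorff topological space. Let $$R \colon K\times E \times G\longrightarrow[0,\infty)\quad\text{and}\quad S\colon \mathcal{H}\times E \times G\longrightarrow[0,\infty)$$ be mappings such that: (i) there is $x_{0}\in E$ such that $R(\varphi,x_{0},b)=S(f,x_{0},b)=0$ for every $\varphi\in K$, $b\in G$ and $f\in\mathcal{H}$; (ii) for every $x\in E$ and $b\in G$, the mapping $R_{x,b}\colon K\longrightarrow[0,\infty)$, $R_{x,b}(\varphi)=R(\varphi,x,b)$, is continuous; (iii) $R(\varphi,x,\eta b)\leq \eta R(\varphi,x,b)$ and $\eta S(f,x,b)\leq S(f,x,\eta b)$ for every $\varphi\in K$, $x\in E$, $0\leq\eta\leq 1$, $b\in G$ and $f\in\mathcal{H}$. Let $0<p<\infty$ and $f\in\mathcal{H}$. Then $f$ is $R$-$S$-abstract $p$-summing if and only if there are a constant $C>0$ and a regular Borel probability measure $\mu$ on $K$ such that $$S(f,x,b)\leq C\left(\int_{K}R(\varphi,x,b)^{p}\,d\mu(\varphi)\right)^{1/p}\quad\text{for all } x\in E \text{ and } b\in G. \qquad ( * )$$ Moreover, in this case, the infimum of the constants $C>0$ for which there is a regular Borel probability measure $\mu$ on $K$ satisfying $( * )$ equals $\pi_{RS,p}(f)^{1/p}$.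
   Context: With $X,Y,E,\mathcal{H},G,K,R,S$ as in the claim and $0<p<\infty$, a mapping $f\in\mathcal{H}$ is called $R$-$S$-abstract $p$-summing if there is a constant $C_{1}>0$ such that $$\sum_{j=1}^{m}S(f,x_{j},b_{j})^{p}\leq C_{1}\sup_{\varphi\in K}\sum_{j=1}^{m}R(\varphi,x_{j},b_{j})^{p}$$ for all $m\in\mathbb{N}$ (positive integers), $x_{1},\ldots,x_{m}\in E$ and $b_{1},\ldots,b_{m}\in G$. The infimum of all such constants $C_{1}$ is denoted by $\pi_{RS,p}(f)$. *)

(* Defs.v *)
From mathcomp Require Import all_boot all_order all_algebra.
From mathcomp Require Import all_classical all_reals all_analysis.
From mathcomp Require Import complex.

Set Implicit Arguments.
Unset Strict Implicit.
Unset Printing Implicit Defensive.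

Import Order.TTheory GRing.Theory Num.Theory.
Import numFieldNormedType.Exports.

Local Open Scope classical_set_scope.
Local Open Scope ring_scope.

Variant scalar_kind := RealScalars | ComplexScalars.

Definition scalars (F : realType) (k : scalar_kind) : numFieldType :=
  match k with
  | RealScalars => F
  | ComplexScalars => F[i]
  end.

Definition real_scalar (F : realType) (k : scalar_kind) : F -> scalars F k :=
  match k return F -> scalars F k with
  | RealScalars => fun x => x
  | ComplexScalars => fun x => x%:C%C
  end.

(* Borel measurable space. [ptopologicalType] is used because [g_sigma_algebraType] only carries its
   measurable structure over a pointed type; the point also makes K nonempty. *)
Notation borel K := (g_sigma_algebraType (@open K)).

Definition regular_measure (F : realType) (K : ptopologicalType)
    (mu : set (borel K) -> \bar F) : Prop :=
  forall A : set (borel K), measurable A ->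
    mu A = ereal_inf [set mu U | U in [set U : set K | open U /\ A `<=` U]] /\
    mu A = ereal_sup [set mu C | C in [set C : set K | compact C /\ C `<=` A]].

Section AbstractSumming.
Context (F : realType) (X Y E G : Type) (H : set (X -> Y)).
Context (K : ptopologicalType).
Variables (R : K -> E -> G -> F) (S : H -> E -> G -> F) (p : F).

(* The supremum is taken in [\bar F], since [sup] on F returns 0 on unbounded
   sets. *)
Definition summing_const (f : H) (C1 : F) : Prop :=
  0 < C1 /\
  forall (m : nat) (x : 'I_m -> E) (b : 'I_m -> G), (0 < m)%N ->
    ((\sum_(j < m) S f (x j) (b j) `^ p)%:E <=
     C1%:E * ereal_sup
       (range (fun phi => (\sum_(j < m) R phi (x j) (b j) `^ p)%:E)))%E.

Definition abstract_summing (f : H) : Prop := exists C1, summing_const f C1.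

Definition pi_RS (f : H) : F := inf [set C1 | summing_const f C1].

Definition domination_const (f : H) (C : F) : Prop :=
  0 < C /\
  exists mu : probability (borel K) F, regular_measure mu /\
    forall (x : E) (b : G),
      ((S f x b)%:E <=
       C%:E * (\int[mu]_(phi in [set: borel K]) (R phi x b `^ p)%:E) `^ p^-1)%E.

End AbstractSumming.

(* Main.v *)
Require Import Defs.
From HB Require Import structures.
From mathcomp Require Import all_boot all_order all_algebra.
From mathcomp Require Import all_classical all_reals all_analysis.
From mathcomp Require Import finmap measurable_realfun lra.

Import Order.TTheory GRing.Theory Num.Theory.
Import numFieldNormedType.Exports.

Local Open Scope classical_set_scope.
Local Open Scope ring_scope.

Set Implicit Arguments.
Unset Strict Implicit.
Unset Printing Implicit Defensive.

(** Why the theorem is true.  Domination gives summability by raising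
    [S <= C (int R^p dmu)^(1/p)] to the power [p], summing over [j] and
    bounding the integral of [sum_j R^p] against a probability by its supremum
    ([domination_summing]).

    For the converse, summability with constant [C1] says that no nonnegative
    combination of the functions [h_(x,b) = C1 R(.,x,b)^p - S(f,x,b)^p] on [K]
    is everywhere below a negative constant.  Weights other than [1] are
    absorbed into the vectors: after a normalisation making every weight
    [eta <= 1], scaling [b] by [eta^(1/p)] multiplies [S^p] by at least [eta]
    and [R^p] by at most [eta] ([summing_weighted]).  By a Hahn-Banach
    argument there is then a normalised positive linear functional [L] on the
    bounded functions on [K] with [L h_(x,b) >= 0] for all [x] and [b]
    ([mean_ge0_on_cone]), that is, [S^p <= C1 L(R^p)].

    It remains to replace [L] by a regular probability measure.  As [L] is
    defined on all bounded functions, and not only on the continuous ones, it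
    restricts to a finitely additive probability on all subsets of [K].  Its
    values on compact sets form a content, and the outer measure of this
    content is, by Caratheodory's theorem, a regular Borel probability [mu]
    with [L 1_C <= mu C] for closed [C] ([content_regular_measure]).
    Decomposing a function into its superlevel sets gives [L g <= int g dmu]
    whenever [g >= 0] is bounded and upper semicontinuous
    ([mean_le_integral]); applied to [g = R^p] this is the domination
    ([summing_domination]).

    Thus [C] dominates exactly when [C^p] is a summing constant, and the two
    infima correspond under the increasing bijection [C |-> C^p]. *)

(** * Linear minorants of sublinear functionals *)

Section sublinear_functionals.
Context {F : realType} {V : lmodType F}.

Definition sublinear (q : V -> F) : Prop :=
  (forall x y, q (x + y) <= q x + q y) /\
  (forall t x, 0 <= t -> q (t *: x) <= t * q x).

Lemma sublinear0 q : sublinear q -> q 0 = 0.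
Proof.
move=> [qD qZ]; apply/eqP; rewrite eq_le; apply/andP; split.
  by have := qZ 0 0 (lexx _); rewrite scale0r mul0r.
by have := qD 0 0; rewrite addr0; lra.
Qed.

Lemma sublinearZ q t x : sublinear q -> 0 <= t -> q (t *: x) = t * q x.
Proof.
move=> sq; rewrite le_eqVlt => /predU1P[<-|t0].
  by rewrite scale0r mul0r sublinear0.
apply/eqP; rewrite eq_le; apply/andP; split; first by apply: sq.2; exact: ltW.
rewrite -ler_pdivlMl//.
have := sq.2 t^-1 (t *: x); rewrite scalerA mulVf ?gt_eqF// scale1r.
by apply; rewrite invr_ge0 ltW.
Qed.

Lemma sublinear_opp q x : sublinear q -> - q (- x) <= q x.
Proof.
by move=> sq; have := sq.1 x (- x); rewrite subrr sublinear0//; lra.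
Qed.

Let minorant q0 := {q : V -> F | sublinear q /\ forall x, q x <= q0 x}.

Let below q0 (q r : minorant q0) := `[< forall x, sval r x <= sval q x >].

(** The chain condition of Zorn's lemma.  The pointwise infimum is finite
    because a sublinear [q <= q0] satisfies [- q0 (- x) <= - q (- x) <= q x]. *)
Lemma sublinear_chain_inf q0 (A : set (minorant q0)) (r0 : minorant q0) :
  A r0 -> total_on A (@below q0) ->
  exists r : minorant q0, forall q, A q -> below q r.
Proof.
move=> Ar0 totA.
pose vals x := [set sval q x | q in A].
pose r x := inf (vals x).
have vals_lb x : has_lbound (vals x).
  exists (- q0 (- x)) => _ [q _ <-].
  have [sq qq0] := svalP q.
  by have := sublinear_opp x sq; have := qq0 (- x); lra.
have rle x q : A q -> r x <= sval q x.
  by move=> Aq; apply: ge_inf => //; exists q.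
have rge x c : (forall q, A q -> c <= sval q x) -> c <= r x.
  move=> h; apply: lb_le_inf; first by exists (sval r0 x), r0.
  by move=> _ [q Aq <-]; exact: h.
have sr : sublinear r.
  split=> [x y|t x t0].
    rewrite -lerBlDr; apply: (rge) => q1 Aq1.
    rewrite lerBlDr -lerBlDl; apply: (rge) => q2 Aq2; rewrite lerBlDl.
    (* in a chain the smaller of the two functionals serves for both summands *)
    have [/asboolP q21|/asboolP q12] := totA _ _ Aq1 Aq2.
      apply: le_trans (rle (x + y) q2 Aq2) _.
      apply: le_trans ((svalP q2).1.1 x y) _.
      by rewrite lerD2r.
    apply: le_trans (rle (x + y) q1 Aq1) _.
    apply: le_trans ((svalP q1).1.1 x y) _.
    by rewrite lerD2l.
  have [->|tn0] := eqVneq t 0.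
    rewrite scale0r mul0r.
    by apply: le_trans (rle 0 r0 Ar0) _; rewrite sublinear0//; case: (svalP r0).
  have {t0 tn0}t0 : 0 < t by rewrite lt_neqAle eq_sym tn0.
  rewrite -ler_pdivrMl//; apply: (rge) => q Aq; rewrite ler_pdivrMl//.
  apply: le_trans (rle _ _ Aq) _.
  by apply: (svalP q).1.2; exact: ltW.
have rq0 x : r x <= q0 x.
  by apply: le_trans (rle x _ Ar0) _; case: (svalP r0).
exists (exist _ r (conj sr rq0)) => q Aq; apply/asboolP => x /=; exact: rle.
Qed.

(** The witness is [r x = inf_(t >= 0) q (x + t y) - t q y].  If [q] is a minimal
    sublinear functional then [r = q], and the second bound turns the
    subadditivity of [q] into additivity. *)
Lemma sublinear_shift q y : sublinear q ->
  exists2 r, sublinear r &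
    (forall x, r x <= q x) /\ forall x, r x <= q (x + y) - q y.
Proof.
move=> sq.
pose vals x := [set q (x + t *: y) - t * q y | t in [set t | 0 <= t]].
pose r x := inf (vals x).
have vals_lb x : has_lbound (vals x).
  exists (- q (- x)) => _ [t /= t0 <-].
  have := sq.1 (x + t *: y) (- x).
  by rewrite addrAC subrr add0r sublinearZ//; lra.
have rle x t : 0 <= t -> r x <= q (x + t *: y) - t * q y.
  by move=> t0; apply: ge_inf => //; exists t.
have rge x c : (forall t, 0 <= t -> c <= q (x + t *: y) - t * q y) -> c <= r x.
  move=> h; apply: lb_le_inf.
    by exists (q (x + 0 *: y) - 0 * q y), 0; rewrite //= lexx.
  by move=> _ [t t0 <-]; exact: h.
have rq x : r x <= q x.
  by have := rle x 0 (lexx _); rewrite scale0r addr0 mul0r subr0.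
exists r; last first.
  by split=> // x; have := rle x 1 ler01; rewrite scale1r mul1r.
split=> [x z|s x].
  rewrite -lerBlDr; apply: (rge) => t t0.
  rewrite lerBlDr -lerBlDl; apply: (rge) => u u0; rewrite lerBlDl.
  apply: le_trans (rle (x + z) (t + u) (addr_ge0 t0 u0)) _.
  rewrite scalerDl addrACA mulrDl.
  by have := sq.1 (x + t *: y) (z + u *: y); lra.
rewrite le_eqVlt => /predU1P[<-|s0].
  by rewrite scale0r mul0r; apply: le_trans (rq 0) _; rewrite sublinear0.
rewrite -ler_pdivrMl//; apply: (rge) => t t0; rewrite ler_pdivrMl//.
apply: le_trans (rle _ (s * t) (mulr_ge0 (ltW s0) t0)) _.
by rewrite -scalerA -scalerDr (sublinearZ _ sq (ltW s0)) mulrBr mulrA.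
Qed.

(** The analytic Hahn-Banach theorem, from the fact that a minimal sublinear
    functional is linear. *)
Theorem sublinear_linear_minorant q0 : sublinear q0 ->
  exists L : {linear V -> F^o}, forall x, L x <= q0 x.
Proof.
move=> sq0.
have q0q0 : sublinear q0 /\ forall x, q0 x <= q0 x by split.
have [||A totA|[q [sq qq0]] qmin] :=
    @ZL_preorder (minorant q0) (exist _ q0 q0q0) (@below q0).
- by move=> r; apply/asboolP.
- move=> r s t /asboolP rs /asboolP st; apply/asboolP => x.
  exact: le_trans (st x) (rs x).
- have [[r0 Ar0]|A0] := pselect (exists r, A r).
    exact: sublinear_chain_inf Ar0 totA.
  by exists (exist _ q0 q0q0) => r Ar; case: A0; exists r.
have qD x y : q (x + y) = q x + q y.
  apply/eqP; rewrite eq_le sq.1/=.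
  have [r sr [rq rshift]] := sublinear_shift y sq.
  have rq0 x' : r x' <= q0 x' by exact: le_trans (rq x') (qq0 x').
  have /asboolP/(_ x)/= qr :
      below (exist _ r (conj sr rq0)) (exist _ q (conj sq qq0)).
    by apply: qmin; apply/asboolP.
  by have := rshift x; move: qr; lra.
have qN x : q (- x) = - q x.
  by apply/eqP; rewrite -addr_eq0 -qD addNr sublinear0.
have qlin : linear (q : V -> F^o).
  move=> t x y; rewrite qD; congr (_ + _).
  have [t0|/ltW t0] := leP 0 t; first exact: sublinearZ.
  have -> : t *: x = (- t) *: (- x) by rewrite scalerN scaleNr opprK.
  by rewrite sublinearZ ?oppr_ge0// qN mulrNN.
pose lq := GRing.isLinear.Build F V F^o _ (q : V -> F^o) qlin.
pose L : {linear V -> F^o} := HB.pack (q : V -> F^o) lq.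
by exists L.
Qed.

End sublinear_functionals.

(** * Means on bounded functions *)

Definition finitely_additive_probability {F : realType} {T : Type}
    (nu : set T -> F) : Prop :=
  [/\ forall A, 0 <= nu A, nu setT = 1 &
      forall A B, A `&` B = set0 -> nu (A `|` B) = nu A + nu B].

Section bounded_functions.
Context {F : realType} {T : Type}.

(** The codomain is [F^o] so that the functions form a module over [F]. *)
Definition bounded_fun : {pred T -> F^o} :=
  fun f => `[< exists M, forall x, `|f x| <= M >].

Lemma bounded_funP f :
  reflect (exists M, forall x, `|f x| <= M) (f \in bounded_fun).
Proof. exact: asboolP. Qed.

Lemma bounded_fun_submod_closed : submod_closed bounded_fun.
Proof.
split=> [|a f g /bounded_funP[M fM] /bounded_funP[N gN]]; apply/bounded_funP.
  by exists 0 => x; rewrite normr0.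
exists (`|a| * M + N) => x; apply: le_trans (ler_normD _ _) _.
by rewrite lerD// normrM ler_wpM2l.
Qed.

HB.instance Definition _ :=
  GRing.isSubmodClosed.Build F (T -> F^o) bounded_fun bounded_fun_submod_closed.

Record bfun := Bfun { bfun_val :> T -> F^o; bfunP : bfun_val \in bounded_fun }.

HB.instance Definition _ := [isSub for bfun_val].
HB.instance Definition _ := [Choice of bfun by <:].
HB.instance Definition _ := [SubChoice_isSubLmodule of bfun by <:].

Lemma bfun_ext (f g : bfun) : f =1 g -> f = g.
Proof. by move=> fg; apply/val_inj/funext. Qed.
Lemma bfunD (f g : bfun) x : (f + g) x = f x + g x. Proof. by []. Qed.
Lemma bfunN (f : bfun) x : (- f) x = - f x. Proof. by []. Qed.
Lemma bfunZ a (f : bfun) x : (a *: f) x = a * f x. Proof. by []. Qed.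
Lemma bfun_sum I (s : seq I) (f : I -> bfun) x :
  (\sum_(i <- s) f i) x = \sum_(i <- s) f i x.
Proof. by elim: s => [|i s IH]; rewrite ?big_nil// !big_cons bfunD IH. Qed.

(** Applied to differences of functions and to the constants [1] and [-1], the
    condition says that [L] is monotone and normalised. *)
Definition mean (L : {linear bfun -> F^o}) : Prop :=
  forall (g : bfun) c, (forall x, g x <= c) -> L g <= c.

(** Let [q g] be the infimum over [h'] in the cone spanned by the [h i] of
    [sup (g + h')].  The hypothesis on the cone makes [q] finite, and [q] is
    sublinear with [q g <= sup g] and [q (- h i) <= 0]; a linear minorant of
    [q] is the required mean. *)
Lemma mean_ge0_on_cone (I : Type) (h : I -> bfun) :
  (forall (s : seq (F * I)) (c : F), all (fun w : F * I => 0 <= w.1) s ->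
     (forall x, \sum_(w <- s) w.1 * h w.2 x <= c) -> 0 <= c) ->
  exists2 L : {linear bfun -> F^o}, mean L & forall i, 0 <= L (h i).
Proof.
move=> h_sup.
pose majorants (g : bfun) : set F := [set c | exists2 s : seq (F * I),
  all (fun w : F * I => 0 <= w.1) s &
  forall x, g x + \sum_(w <- s) w.1 * h w.2 x <= c].
pose q g := inf (majorants g).
have maj_lb g : has_lbound (majorants g).
  have /bounded_funP[M gM] := bfunP g.
  exists (- M) => c [s s0 gc]; rewrite -subr_ge0 opprK.
  apply: (h_sup s) => // x.
  by have := gc x; have := gM x; rewrite ler_norml => /andP[]; lra.
have maj_le (g : bfun) c : (forall x, g x <= c) -> majorants g c.
  by move=> gc; exists [::] => // x; rewrite big_nil addr0.
have maj_neq0 g : majorants g !=set0.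
  have /bounded_funP[M gM] := bfunP g.
  by exists M; apply: maj_le => x; apply: le_trans (ler_norm _) (gM x).
have qle g c : majorants g c -> q g <= c by move=> gc; exact: ge_inf.
have qD f g : q (f + g) <= q f + q g.
  rewrite -lerBlDr; apply: lb_le_inf => // c [s s0 fc].
  rewrite lerBlDr -lerBlDl; apply: lb_le_inf => // d [r r0 gd].
  rewrite lerBlDl; apply: qle; exists (s ++ r); first by rewrite all_cat s0 r0.
  by move=> x; rewrite big_cat bfunD/=; have := fc x; have := gd x; lra.
have qZ t g : 0 <= t -> q (t *: g) <= t * q g.
  rewrite le_eqVlt => /predU1P[<-|t0].
    by rewrite scale0r mul0r; apply/qle/maj_le.
  rewrite -ler_pdivrMl//; apply: lb_le_inf => // c [s s0 gc].
  rewrite ler_pdivrMl//; apply: qle; exists [seq (t * w.1, w.2) | w <- s].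
    by rewrite all_map; apply: sub_all s0 => w /= w0; rewrite mulr_ge0// ltW.
  move=> x; rewrite big_map bfunZ/=.
  under eq_bigr do rewrite -mulrA.
  by rewrite -mulr_sumr -mulrDr ler_pM2l.
have [L Lq] := sublinear_linear_minorant (conj qD qZ).
exists L => [g c gc|i]; first by apply: le_trans (Lq g) _; apply/qle/maj_le.
rewrite -oppr_le0 -linearN; apply: le_trans (Lq _) _; apply: qle.
exists [:: (1, i)] => [|x]; first by rewrite /= ler01.
by rewrite big_seq1 bfunN/= mul1r addNr.
Qed.

Lemma le_mean L (f g : bfun) : mean L -> (forall x, f x <= g x) -> L f <= L g.
Proof.
move=> mL fg; rewrite -subr_le0 -linearB; apply: mL => x.
by rewrite bfunD bfunN subr_le0.
Qed.

Lemma indic_bounded_fun (A : set T) : (\1_A : T -> F^o) \in bounded_fun.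
Proof.
by apply/bounded_funP; exists 1 => x; rewrite indicE normr_nat lern1 leq_b1.
Qed.

Definition bfun_indic (A : set T) : bfun := Bfun (indic_bounded_fun A).

Lemma bfun_indicE A x : bfun_indic A x = (x \in A)%:R.
Proof. exact: indicE. Qed.

Lemma mean_indic L : mean L ->
  finitely_additive_probability (fun A => L (bfun_indic A)).
Proof.
move=> mL; split.
- move=> A; rewrite -(linear0 L); apply: le_mean => // x.
- apply/eqP; rewrite eq_le; apply/andP; split.
    by apply: mL => x; rewrite /= indicE in_setT.
  rewrite -lerN2 -linearN; apply: mL => x.
  by rewrite bfunN bfun_indicE in_setT.
- move=> A B AB; rewrite -linearD; congr (L _); apply: bfun_ext => x.
  have : ~~ ((x \in A) && (x \in B)) by rewrite -in_setI AB in_set0.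
  rewrite bfunD !bfun_indicE in_setU.
  case: (x \in A); case: (x \in B) => //= _.
  by rewrite addr0.
  by rewrite add0r.
  by rewrite add0r.
Qed.

End bounded_functions.
Arguments bfun : clear implicits.

(** * From finitely additive probabilities to regular measures *)

Section content_to_measure.
Context {F : realType} {K : ptopologicalType}.
Hypotheses (K_compact : compact [set: K]) (K_hausdorff : hausdorff_space K).
Variable nu : set K -> F.
Hypothesis nu_prob : finitely_additive_probability nu.

Let nu_ge0 A : 0 <= nu A. Proof. by case: nu_prob. Qed.

Let nuU A B : A `&` B = set0 -> nu (A `|` B) = nu A + nu B.
Proof. by case: nu_prob => _ _; exact. Qed.

Let nuT : nu setT = 1. Proof. by case: nu_prob. Qed.

Let nu_le A B : A `<=` B -> nu A <= nu B.
Proof.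
move=> AB; rewrite -(setDUK AB) nuU ?setDIK// lerDl; exact: nu_ge0.
Qed.

Let nuU_le A B : nu (A `|` B) <= nu A + nu B.
Proof.
rewrite (_ : A `|` B = A `|` (B `\` A)) ?nuU ?setDIK//.
  by rewrite lerD2l; apply: nu_le => x [].
apply/seteqP; split=> [x [Ax|Bx]|x [Ax|[Bx _]]]; try by [left|right].
by have [Ax|nAx] := pselect (A x); [left|right].
Qed.

Local Open Scope ereal_scope.

Definition inner_content (U : set K) : \bar F :=
  ereal_sup [set (nu C)%:E | C in [set C | closed C /\ C `<=` U]].

Definition outer_content (A : set K) : \bar F :=
  ereal_inf [set inner_content U | U in [set U | open U /\ A `<=` U]].

Lemma content_le_inner C U : closed C -> C `<=` U -> (nu C)%:E <= inner_content U.
Proof. by move=> cC CU; apply: ereal_sup_ubound; exists C. Qed.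

Lemma inner_content_ge0 U : 0 <= inner_content U.
Proof.
apply: le_trans (content_le_inner closed0 (@sub0set _ U)).
by rewrite lee_fin.
Qed.

Lemma inner_content_le1 U : inner_content U <= 1.
Proof.
apply: ge_ereal_sup => _ [C _ <-]; rewrite lee_fin -nuT; exact: nu_le.
Qed.

Lemma le_inner_content U V : U `<=` V -> inner_content U <= inner_content V.
Proof.
move=> UV; apply: ge_ereal_sup => _ [C [cC CU] <-].
by apply: content_le_inner => // x /CU/UV.
Qed.

Lemma outer_content_le A U : open U -> A `<=` U -> outer_content A <= inner_content U.
Proof. by move=> oU AU; apply: ereal_inf_lbound; exists U. Qed.

Lemma le_outer_content A B : A `<=` B -> outer_content A <= outer_content B.
Proof.
move=> AB; apply: le_ereal_inf_tmp => _ [U [oU BU] <-].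
by apply: outer_content_le => // x /AB/BU.
Qed.

Lemma outer_content_open U : open U -> outer_content U = inner_content U.
Proof.
move=> oU; apply/eqP; rewrite eq_le outer_content_le//=.
by apply: le_ereal_inf_tmp => _ [V [oV UV] <-]; exact: le_inner_content.
Qed.

Lemma outer_content_ge0 A : 0 <= outer_content A.
Proof. by apply: le_ereal_inf_tmp => _ [U _ <-]; exact: inner_content_ge0. Qed.

Lemma outer_content_fin_num A : outer_content A \is a fin_num.
Proof.
rewrite ge0_fin_numE ?outer_content_ge0//.
apply: le_lt_trans (ltry 1).
apply: le_trans (outer_content_le openT (@subsetT _ A)) _.
exact: inner_content_le1.
Qed.

Lemma content_le_outer C : closed C -> (nu C)%:E <= outer_content C.
Proof.
by move=> cC; apply: le_ereal_inf_tmp => _ [U [_ CU] <-]; exact: content_le_inner.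
Qed.

Lemma outer_contentT : outer_content setT = 1.
Proof.
apply/eqP; rewrite eq_le outer_content_open ?inner_content_le1//=; last exact: openT.
by rewrite -nuT; apply: content_le_inner => //; exact: closedT.
Qed.

Lemma outer_content0 : outer_content set0 = 0.
Proof.
apply/eqP; rewrite eq_le outer_content_ge0 andbT outer_content_open; last exact: open0.
apply: ge_ereal_sup => _ [C [_ C0] <-].
have -> : C = set0 by apply/seteqP; split.
have := @nuU set0 set0; rewrite setU0 setI0 => /(_ erefl) h.
by rewrite lee_fin; lra.
Qed.

(** By normality of [K], a closed set covered by two open sets is the union of
    two closed sets, one inside each of them. *)
Lemma inner_contentU U V : open U -> open V ->
  inner_content (U `|` V) <= inner_content U + inner_content V.
Proof.
move=> oU oV; apply: ge_ereal_sup => _ [C [cC CUV] <-].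
have clD (A B : set K) : closed A -> open B -> closed (A `\` B).
  by move=> cA oB; rewrite setDE; apply: closedI => //; exact: open_closedC.
have disj : (C `\` U) `&` (C `\` V) = set0.
  by apply/seteqP; split=> // x [[Cx nUx] [_ nVx]]; case: (CUV x Cx).
have := compact_normal K_hausdorff K_compact.
move=> /(@normal_openP F)/(_ _ _ (@clD C U cC oU) (@clD C V cC oV) disj).
move=> [P [Q [oP oQ CUP CVQ PQ0]]].
have -> : C = (C `\` P) `|` (C `\` Q).
  apply/seteqP; split=> [x Cx|x [[]|[]]//].
  have [Px|nPx] := pselect (P x); last by left.
  by right; split=> // Qx; have : (P `&` Q) x by []; rewrite PQ0.
apply: (@le_trans _ _ ((nu (C `\` P))%:E + (nu (C `\` Q))%:E)).
  by rewrite -EFinD lee_fin.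
apply: leeD; apply: content_le_inner.
- exact: clD.
- by move=> x [Cx nPx]; apply: contrapT => nUx; apply: nPx; exact: CUP.
- exact: clD.
- by move=> x [Cx nQx]; apply: contrapT => nVx; apply: nQx; exact: CVQ.
Qed.

Lemma inner_content_bigU (U : (set K)^nat) n : (forall i, open (U i)) ->
  inner_content (\big[setU/set0]_(i < n) U i) <=
  \sum_(0 <= i < n) inner_content (U i).
Proof.
move=> oU; elim: n => [|n IH].
  by rewrite big_ord0 big_nil -outer_content_open ?outer_content0//; exact: open0.
rewrite big_ord_recr big_nat_recr//=; apply: le_trans (inner_contentU _ (oU n)) _.
  by rewrite -bigcup_mkord; apply: bigcup_open => i _; exact: oU.
exact: leeD2r.
Qed.

(** Compactness reduces the countable cover of a closed set to a finite one. *)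
Lemma inner_content_bigcup (U : (set K)^nat) : (forall i, open (U i)) ->
  inner_content (\bigcup_i U i) <= \sum_(i <oo) inner_content (U i).
Proof.
move=> oU; apply: ge_ereal_sup => _ [C [cC CU] <-].
have : compact C by exact: subclosed_compact K_compact _.
rewrite compact_cover => /(_ nat setT U (fun i _ => oU i) CU)[D _ CD].
(* the finite subcover is enlarged to an initial segment of the family *)
have [n Dn] : exists n, forall i, i \in D -> (i < n)%N.
  exists (\max_(i <- D) i).+1 => i iD; rewrite ltnS.
  exact: (@leq_bigmax_seq _ _ _ (fun j : nat => j)).
apply: le_trans (nneseries_lim_ge n _); last by move=> *; exact: inner_content_ge0.
apply: le_trans (inner_content_bigU n oU).
apply: content_le_inner => // x /CD[i /= iD Uix].
by rewrite -bigcup_mkord; exists i => //=; exact: Dn.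
Qed.

Lemma outer_content_sigma_subadditive : sigma_subadditive outer_content.
Proof.
move=> A; apply/lee_addgt0Pr => e e0.
apply: le_trans (epsilon_trick xpredT _ (ltW e0)); last first.
  by move=> n; exact: outer_content_ge0.
have [U PU] : {U : (set K)^nat & forall n, [/\ open (U n), A n `<=` U n &
    inner_content (U n) <= outer_content (A n) + (e / (2 ^ n.+1)%:R)%:E]}.
  apply: (@choice _ _ (fun n V => [/\ open V, A n `<=` V & inner_content V <=
    outer_content (A n) + (e / (2 ^ n.+1)%:R)%:E])) => n.
  have en : (0 < e / (2 ^ n.+1)%:R)%R by rewrite divr_gt0// ltr0n expn_gt0.
  have [_ [V [oV AV] <-] /ltW Ve] :=
    lb_ereal_inf_adherent en (outer_content_fin_num (A n)).
  by exists V.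
apply: (@le_trans _ _ (inner_content (\bigcup_n U n))).
  apply: outer_content_le => [|x [n _ Anx]].
    by apply: bigcup_open => n _; have [] := PU n.
  by exists n => //; have [_ + _] := PU n; apply.
apply: le_trans (inner_content_bigcup _) _; first by move=> n; have [] := PU n.
by apply: lee_nneseries => n *; [exact: inner_content_ge0|have [] := PU n].
Qed.

(** For open [A], exhaust [A `&` U] from inside by a closed [C] and then
    [A `\` C], which is open and contains [A `\` U], by a closed [D]: the sets
    [C] and [D] are disjoint and lie in [A], so that the additivity of [nu]
    bounds the sum of their contents by the inner content of [A]. *)
Lemma outer_content_open_caratheodory U : open U ->
  forall X, outer_content (X `&` U) + outer_content (X `&` ~` U) <= outer_content X.
Proof.
move=> oU X; apply: le_ereal_inf_tmp => _ [A [oA XA] <-].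
apply: (@le_trans _ _ (inner_content (A `&` U) + outer_content (A `&` ~` U))).
  apply: leeD; last by apply: le_outer_content; exact: setSI.
  by apply: outer_content_le; [exact: openI|exact: setSI].
rewrite -leeBrDr ?outer_content_fin_num//.
apply: ge_ereal_sup => _ [C [cC CAU] <-].
rewrite leeBrDr ?outer_content_fin_num// addeC -leeBrDr//.
have oAC : open (A `&` ~` C) by apply: openI => //; exact: closed_openC.
apply: (@le_trans _ _ (inner_content (A `&` ~` C))).
  by apply: outer_content_le => // x [Ax nUx]; split=> // /CAU[].
apply: ge_ereal_sup => _ [D [cD DAC] <-].
rewrite leeBrDr// -EFinD -nuU; last first.
  by apply/seteqP; split=> // x [/DAC[]].
apply: content_le_inner; first exact: closedU.
by move=> x [/DAC[]|/CAU[]].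
Qed.

(** Outer regularity is built into the outer content; inner regularity follows
    by passing to complements, closed sets being compact. *)
Theorem content_regular_measure :
  exists mu : probability (borel K) F, regular_measure mu /\
    forall C, closed C -> (nu C)%:E <= mu C.
Proof.
pose om := isOuterMeasure.Build F K outer_content outer_content0
  outer_content_ge0 le_outer_content outer_content_sigma_subadditive.
pose mo : {outer_measure set K -> \bar F} := HB.pack outer_content om.
have cara A : (measurable : set (set (borel K))) A -> mo.-caratheodory A.
  have : (measurable : set (set (borel K))) `<=` mo.-cara.-measurable.
    apply: smallest_sub.
      split=> //; [by move=> X mX; rewrite setTD; exact: measurableC |
                   by move=> u_ mu_; exact: bigcupT_measurable].
    move=> U oU; apply: le_caratheodory_measurable.
    exact: outer_content_open_caratheodory.
  exact.
pose m : set (borel K) -> \bar F := outer_content.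
have m_sigma : semi_sigma_additive m.
  move=> A mA tA mUA; apply: (@caratheodory_measure_sigma_additive _ _ mo) => //.
    by move=> i; exact: cara.
  exact: cara.
pose mM := isMeasure.Build _ _ _ m outer_content0 outer_content_ge0 m_sigma.
pose mm : {measure set (borel K) -> \bar F} := HB.pack m mM.
pose mP := Measure_isProbability.Build _ _ _ mm outer_contentT.
pose mu : probability (borel K) F := HB.pack m mM mP.
have muE A : mu A = outer_content A by [].
exists mu; split=> [A mA|]; last exact: content_le_outer.
split.
  rewrite muE /outer_content; congr ereal_inf.
  by apply/seteqP; split=> _ [U [oU AU] <-]; exists U; rewrite // muE outer_content_open.
apply/eqP; rewrite eq_le; apply/andP; split; last first.
  apply: ge_ereal_sup => _ [C [cC CA] <-]; exact: le_outer_content.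
apply/lee_addgt0Pr => e e0.
have [_ [U [oU AU] <-] /ltW] :=
  lb_ereal_inf_adherent e0 (outer_content_fin_num (~` A)).
rewrite -/(outer_content (~` A)) => Ue.
have mU : measurable (U : set (borel K)) by exact: sub_sigma_algebra.
have cU : compact (~` U).
  by apply: subclosed_compact K_compact _ => //; exact: open_closedC.
apply: (@le_trans _ _ (mu (~` U) + e%:E)); last first.
  apply: leeD2r; apply: ereal_sup_ubound; exists (~` U) => //; split=> //.
  by move=> x nUx; apply: contrapT => nAx; apply: nUx; exact: AU.
have -> : mu (~` U) = 1 - outer_content U by exact: probability_setC.
have -> : mu A = 1 - outer_content (~` A).
  by rewrite -{1}(setCK A); apply: probability_setC; exact: measurableC.
move: Ue; rewrite -(outer_content_open oU) -(fineK (outer_content_fin_num U)).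
rewrite -(fineK (outer_content_fin_num (~` A))) -EFinD -!EFinB -EFinD !lee_fin.

lra.
Qed.

End content_to_measure.

(** * Integral representation of means *)

(** The sum is the integer part of [y] plus one. *)
Lemma sum_le_indicator_staircase {F : realType} (y : F) (N : nat) :
  0 <= y < N%:R ->
  y <= \sum_(k < N) ((k%:R : F) <= y)%R%:R <= y + 1.
Proof.
move=> /andP[y0 yN].
have -> : \sum_(k < N) ((k%:R : F) <= y)%R%:R = (Num.truncn y).+1%:R :> F.
  have tN : ((Num.truncn y).+1 <= N)%N by rewrite truncn_lt_nat.
  under eq_bigr do rewrite -truncn_ge_nat// -ltnS.
  rewrite -natr_sum -big_mkcond -(big_ord_widen _ (fun=> 1%N) tN).
  by rewrite sum1_card card_ord.
have := truncn_itv y0; rewrite -natr1 => /andP[? ?]; apply/andP; split; lra.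
Qed.

Section mean_to_measure.
Context {F : realType} {K : ptopologicalType}.
Hypotheses (K_compact : compact [set: K]) (K_hausdorff : hausdorff_space K).

Lemma closed_borel (C : set K) : closed C -> measurable (C : set (borel K)).
Proof.
move=> cC; rewrite -(setCK C); apply: measurableC.
by apply: sub_sigma_algebra; exact: closed_openC.
Qed.

Lemma measurable_fun_closed_superlevel (g : K -> F) :
  (forall c, closed [set x | c <= g x]) ->
  measurable_fun [set: borel K] g.
Proof.
move=> cg; apply: (measurability (@RGenCInfty.G F)) => [|_ [_ [r] -> <-]].
  exact: RGenCInfty.measurableE.
rewrite setTI preimage_itvcy.
exact: closed_borel (cg r).
Qed.

(** The superlevel sets of an upper semicontinuous [g] are closed, so [mu]
    dominates [L] on their indicators.  The function [(n+1) g] lies between the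
    sum of the indicators of its first integer superlevel sets minus [1] and
    that sum itself, whence [L g <= int g dmu + 1/(n+1)]. *)
Theorem mean_le_integral (L : {linear bfun F K -> F^o}) : mean L ->
  exists mu : probability (borel K) F, regular_measure mu /\
    forall g : bfun F K, (forall x, 0 <= g x) ->
      (forall c, closed [set x | c <= g x]) ->
      ((L g)%:E <= \int[mu]_(x in [set: borel K]) (g x)%:E)%E.
Proof.
move=> mL.
have [mu [mu_reg nu_mu]] :=
  content_regular_measure K_compact K_hausdorff (mean_indic mL).
exists mu; split=> // g g0 g_usc.
have mg := measurable_fun_closed_superlevel g_usc.
have [M gM] := bounded_funP _ (bfunP g).
have step n : (n.+1%:R%:E * (L g)%:E <=
    n.+1%:R%:E * \int[mu]_(x in [set: borel K]) (g x)%:E + 1)%E.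
  (* N exceeds (n + 1) g, so that the first N superlevel sets exhaust it *)
  have [N ngN] : exists N, forall x, 0 <= n.+1%:R * g x < N%:R.
    exists (Num.truncn (n.+1%:R * M)).+1 => x; rewrite mulr_ge0//=.
    apply: le_lt_trans (truncnS_gt _).
    by rewrite ler_pM2l//; apply: le_trans (ler_norm _) (gM x).
  pose E (k : nat) : set (borel K) := [set x | k%:R <= n.+1%:R * g x].
  have cE k : closed (E k : set K).
    rewrite (_ : E k = [set x | n.+1%:R^-1 * k%:R <= g x])//.
    by apply/seteqP; split=> x; rewrite /E/= ler_pdivrMl.
  have mE k : measurable (E k).
    exact: closed_borel (cE k).
  have Eval k x : \1_(E k) x = ((k%:R : F) <= n.+1%:R * g x)%R%:R :> F.
    by rewrite indicE mem_setE.
  apply: (@le_trans _ _ (\sum_(k < N) mu (E k))%E).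
    rewrite -EFinM -[_ * _]/(n.+1%:R *: (L g : F^o)) -linearZ.
    apply: (@le_trans _ _ (L (\sum_(k < N) bfun_indic (E k)))%:E).
      rewrite lee_fin; apply: le_mean => // x; rewrite bfun_sum.
      under eq_bigr do rewrite bfun_indicE mem_setE.
      by have /andP[] := sum_le_indicator_staircase (ngN x).
    rewrite linear_sum -sumEFin; apply: lee_sum => k _.
    exact: nu_mu.
  under eq_bigr do rewrite -(setIT (E _)) -integral_indic//.
  rewrite -ge0_integral_sum//; last first.
    by move=> k; apply/measurable_EFinP.
  have mgE : measurable_fun [set: borel K] (fun x => (g x)%:E) by exact/measurable_EFinP.
  have gE0 (x : K) : (0 <= (g x)%:E)%E by rewrite lee_fin.
  rewrite -ge0_integralZl ?lee_fin//.
  have -> : 1%E = (\int[mu]_(x in [set: borel K]) cst 1%E x)%E.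
    by rewrite integral_cst// mul1e; apply/esym/probability_setT.
  rewrite -ge0_integralD//; last 2 first.
    by move=> x _; rewrite mule_ge0.
    exact: measurable_funeM.
  apply: ge0_le_integral => //.
  - by move=> x _; apply: sume_ge0 => k _; rewrite lee_fin.
  - by apply: emeasurable_sum => k; apply/measurable_EFinP.
  - by apply: emeasurable_funD => //; exact: measurable_funeM.
  move=> x _; rewrite sumEFin -EFinM -EFinD lee_fin.
  under eq_bigr do rewrite Eval.
  by have /andP[] := sum_le_indicator_staircase (ngN x).
have : (0 <= \int[mu]_(x in [set: borel K]) (g x)%:E)%E.
  by apply: integral_ge0 => x _; rewrite lee_fin.
case: (integral mu _ _) step => [r step _|_ _|//]; last by rewrite leey.
rewrite lee_fin leNgt; apply/negP => rL.
(* were L g > r, step would fail as soon as n + 1 > 1 / (L g - r) *)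
have {rL}Lr : 0 < L g - r by rewrite subr_gt0.
have := step (Num.truncn ((L g - r)^-1)).
have := truncnS_gt ((L g - r)^-1).
set n := (Num.truncn _).+1%:R.
by rewrite -[ltLHS]mul1r ltr_pdivrMr// mulrBr -!EFinM -EFinD lee_fin; lra.
Qed.

End mean_to_measure.

(** * Pietsch domination *)

Lemma le_poweR {F : realType} (r : F) (x y : \bar F) :
  0 <= r -> (0 <= x -> x <= y -> x `^ r <= y `^ r)%E.
Proof.
move=> r0 x0 xy; apply: gt0_ler_poweR => //; rewrite in_itv/= leey andbT//.
exact: le_trans xy.
Qed.

Section powers.
Context {F : realType} {K : topologicalType} (g : K -> F) (p : F).
Hypotheses (g_ge0 : forall x, 0 <= g x) (g_continuous : continuous g).
Hypothesis p_gt0 : 0 < p.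

(** [powR ^~ p] takes the value [1] at negative arguments and so is not
    continuous at [0]; hence the detour through the superlevel sets, those of
    [g `^ p] being superlevel sets of [g] as [g] is nonnegative. *)
Lemma closed_superlevel_powR c : closed [set x | c <= g x `^ p].
Proof.
have [c0|c0] := leP c 0.
  rewrite (_ : [set x | _] = setT); first exact: closedT.
  by apply/seteqP; split=> // x _ /=; apply: le_trans c0 (powR_ge0 _ _).
have cp : (c `^ p^-1) `^ p = c by rewrite -powRrM mulVf ?gt_eqF// powRr1// ltW.
rewrite (_ : [set x | _] = g @^-1` [set y | c `^ p^-1 <= y]).
  by apply: closed_comp => [x _|]; [exact: g_continuous|exact: closed_ge].
apply/seteqP; split=> x /= h; last first.
  by rewrite -cp ge0_ler_powR ?nnegrE ?powR_ge0// ltW.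
rewrite leNgt; apply/negP => gc; move: h; rewrite leNgt => /negP; apply.
by rewrite -[ltRHS]cp gt0_ltr_powR ?nnegrE ?powR_ge0.
Qed.

Lemma powR_bounded_fun : compact [set: K] ->
  (fun x => g x `^ p : F^o) \in bounded_fun.
Proof.
move=> cK; apply/bounded_funP.
have [M [_ gM]] : bounded_set (g @` setT).
  by apply: compact_bounded; apply: continuous_compact => //; exact: continuous_subspaceT.
have {}gM x : g x <= M + 1.
  by apply: le_trans (ler_norm _) _; apply: gM; [rewrite ltrDl|exists x].
exists ((M + 1) `^ p) => x.
rewrite ger0_norm ?powR_ge0//.
by apply: ge0_ler_powR; rewrite ?nnegrE ?(le_trans (g_ge0 x) (gM x)) ?g_ge0 ?gM ?ltW.
Qed.

End powers.

Section pietsch.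
Context {F : realType} {k : scalar_kind} {X Y E : Type} {H : set (X -> Y)}.
Context {G : completeNormedModType (scalars F k)} {K : ptopologicalType}.
Variables (R : K -> E -> G -> F) (S : H -> E -> G -> F).
Hypotheses (K_compact : compact [set: K]) (K_hausdorff : hausdorff_space K).
Hypotheses (R_ge0 : forall phi x b, 0 <= R phi x b).
Hypotheses (S_ge0 : forall f x b, 0 <= S f x b).
Hypothesis R_continuous : forall x b, continuous (fun phi : K => R phi x b).
Hypothesis RS_scale : forall (phi : K) (x : E) (eta : F) (b : G) (f : H),
  0 <= eta <= 1 ->
  R phi x (real_scalar k eta *: b) <= eta * R phi x b /\
  eta * S f x b <= S f x (real_scalar k eta *: b).
Variables (p : F) (p_gt0 : 0 < p) (f : H).

Let R_usc x b c : closed [set phi | c <= R phi x b `^ p].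
Proof. exact: closed_superlevel_powR. Qed.

Lemma domination_summing C : domination_const R S p f C ->
  summing_const R S p f (C `^ p).
Proof.
move=> [C0 [mu [_ SR]]]; split=> [|m x b _]; first exact: powR_gt0.
have mR x' b' : measurable_fun [set: borel K] (fun phi => (R phi x' b' `^ p)%:E).
  by apply/measurable_EFinP; exact: measurable_fun_closed_superlevel.
have Rp0 x' b' (phi : borel K) : (0 <= (R phi x' b' `^ p)%:E)%E.
  by rewrite lee_fin powR_ge0.
have SpR x' b' : ((S f x' b' `^ p)%:E <=
    (C `^ p)%:E * \int[mu]_(phi in [set: borel K]) (R phi x' b' `^ p)%:E)%E.
  have I0 : (0 <= \int[mu]_(phi in [set: borel K]) (R phi x' b' `^ p)%:E)%E.
    exact: integral_ge0.
  (* the integral is written as (I `^ p^-1) `^ p to compare p-th powers *)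
  rewrite -!poweR_EFin -[X in (_ * X)%E](poweRe1 I0).
  rewrite -{1}(mulVf (lt0r_neq0 p_gt0)).
  rewrite poweRrM -poweRM ?poweR_ge0 ?lee_fin ?(ltW C0)//.
  by apply: le_poweR; rewrite ?lee_fin// ltW.
rewrite -sumEFin; apply: le_trans (lee_sum _ (fun j _ => SpR (x j) (b j))) _.
rewrite -ge0_sume_distrr; last by move=> j _; exact: integral_ge0.
apply: lee_wpmul2l; first by rewrite lee_fin powR_ge0.
rewrite -ge0_integral_sum//.
set sup := ereal_sup _.
have le_sup phi : (\sum_(j < m) (R phi (x j) (b j) `^ p)%:E <= sup)%E.
  by rewrite sumEFin; apply: ereal_sup_ubound; exists phi.
have sup0 : (0 <= sup)%E.
  apply: (@le_trans _ _ (\sum_(j < m) (R point (x j) (b j) `^ p)%:E)%E) => //.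
  by apply: sume_ge0 => j _; exact: Rp0.
apply: (@le_trans _ _ (\int[mu]_(phi in [set: borel K]) cst sup phi)%E).
  apply: ge0_le_integral => //.
  - by move=> phi _; apply: sume_ge0 => j _; exact: Rp0.
  - exact: emeasurable_sum.
by rewrite integral_cst//= probability_setT mule1.
Qed.

Let Rp x b : bfun F K := Bfun (powR_bounded_fun (p := p)
  (fun phi => R_ge0 phi x b) (@R_continuous x b) p_gt0 K_compact).

(** The summing inequality for unit weights implies the one for arbitrary
    nonnegative weights: dividing by an upper bound [t] of the weights makes
    them at most [1], and a weight [eta <= 1] is absorbed by scaling [b] by
    [eta `^ p^-1]. *)
Lemma summing_weighted C1 (s : seq (F * (E * G))) (c : F) :
  summing_const R S p f C1 ->
  all (fun w : F * (E * G) => 0 <= w.1) s ->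
  (forall phi, \sum_(w <- s) w.1 *
     (C1 * R phi w.2.1 w.2.2 `^ p - S f w.2.1 w.2.2 `^ p) <= c) ->
  0 <= c.
Proof.
move=> [C10 C1sum] s0 sc.
have [s_empty|m_gt0] := posnP (size s).
  by have := sc point; rewrite (size0nil s_empty) big_nil.
pose w (j : 'I_(size s)) := tnth (in_tuple s) j.
have w0 j : 0 <= (w j).1 by have /all_tnthP := s0 : all _ (in_tuple s); apply.
(* the summand 1 keeps t positive when all the weights vanish *)
pose t := 1 + \sum_j (w j).1.
have t0 : 0 < t by rewrite ltr_pwDl// sumr_ge0.
pose eta j := (w j).1 / t.
have eta0 j : 0 <= eta j by rewrite divr_ge0// ltW.
have eta1 j : eta j <= 1.
  rewrite ler_pdivrMr// mul1r /t (bigD1 j)//= addrCA lerDl.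
  by rewrite addr_ge0// sumr_ge0.
pose root j := eta j `^ p^-1.
have rootK j : root j `^ p = eta j by rewrite -powRrM mulVf ?gt_eqF// powRr1.
have root01 j : 0 <= root j <= 1.
  rewrite powR_ge0/=; have <- : 1 `^ p^-1 = 1 :> F by rewrite powR1.
  by apply: ge0_ler_powR; rewrite ?nnegrE// invr_ge0 ltW.
pose x j := (w j).2.1.
pose b j := (w j).2.2.
pose b' j := real_scalar k (root j) *: b j.
have Rb' phi j : R phi (x j) (b' j) `^ p <= eta j * R phi (x j) (b j) `^ p.
  rewrite -rootK -powRM ?powR_ge0//.
  apply: ge0_ler_powR; rewrite ?nnegrE ?mulr_ge0 ?powR_ge0 ?(ltW p_gt0)//.
  by have [] := RS_scale phi (x j) (b j) f (root01 j).
have Sb' j : eta j * S f (x j) (b j) `^ p <= S f (x j) (b' j) `^ p.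
  rewrite -rootK -powRM ?powR_ge0//.
  apply: ge0_ler_powR; rewrite ?nnegrE ?mulr_ge0 ?powR_ge0 ?(ltW p_gt0)//.
  by have [] := RS_scale point (x j) (b j) f (root01 j).
have le_c phi : C1 * \sum_j R phi (x j) (b' j) `^ p <=
    \sum_j S f (x j) (b' j) `^ p + c / t.
  have := sc phi; rewrite -(ler_pM2r (_ : 0 < t^-1)) ?invr_gt0//.
  rewrite big_tnth mulr_suml => etac.
  rewrite -lerBlDl; apply: le_trans etac; rewrite mulr_sumr -sumrB.
  apply: ler_sum => j _; rewrite mulrAC mulrBr; apply: lerB; last exact: Sb'.
  by rewrite mulrCA ler_pM2l.
have := C1sum _ x b' m_gt0; set sup := ereal_sup _ => S_le.
suff : (C1%:E * sup <= (\sum_j S f (x j) (b' j) `^ p + c / t)%:E)%E.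
  by move=> /(le_trans S_le); rewrite lee_fin lerDl pmulr_lge0// invr_gt0.
rewrite -lee_pdivlMl//; apply: ge_ereal_sup => _ [phi _ <-].
by rewrite lee_pdivlMl// -EFinM lee_fin.
Qed.

Lemma summing_domination C1 : summing_const R S p f C1 ->
  domination_const R S p f (C1 `^ p^-1).
Proof.
move=> C1sum; have C10 := C1sum.1; split; first exact: powR_gt0.
pose h (i : E * G) : bfun F K :=
  C1 *: Rp i.1 i.2 - (S f i.1 i.2 `^ p) *: bfun_indic setT.
have hE i phi : h i phi = C1 * R phi i.1 i.2 `^ p - S f i.1 i.2 `^ p.
  by rewrite bfunD bfunN !bfunZ bfun_indicE in_setT mulr1.
have [|L mL Lh] := @mean_ge0_on_cone _ _ _ h.
  move=> s c s0 sc; apply: (summing_weighted C1sum s0) => phi.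
  by apply: le_trans (sc phi); apply: ler_sum => w _; rewrite hE.
have [mu [mu_reg L_le]] := mean_le_integral K_compact K_hausdorff mL.
exists mu; split=> // x b.
have Sp : S f x b `^ p <= C1 * L (Rp x b).
  have := Lh (x, b); rewrite linearB !linearZ/=.
  have [_ -> _] := mean_indic mL; rewrite scalerN subr_ge0 [_ *: 1]mulr1; exact.
have I_ge := L_le (Rp x b) (fun phi => powR_ge0 _ _) (@R_usc x b).
have I0 : (0 <= \int[mu]_(phi in [set: borel K]) (R phi x b `^ p)%:E)%E.
  by apply: integral_ge0 => phi _; rewrite lee_fin powR_ge0.
have -> : S f x b = (S f x b `^ p) `^ p^-1.
  by rewrite -powRrM mulfV ?gt_eqF// powRr1.
rewrite -!poweR_EFin -poweRM ?lee_fin ?(ltW C10)//.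
apply: le_poweR; rewrite ?invr_ge0 ?(ltW p_gt0) ?lee_fin ?powR_ge0//.
apply: (@le_trans _ _ (C1 * L (Rp x b))%:E); first by rewrite lee_fin.
by rewrite EFinM lee_pmul2l// lte_fin.
Qed.

End pietsch.

Theorem theorem2p2 (F : realType) (k : scalar_kind) (X Y E : Type)
    (H : set (X -> Y)) (G : completeNormedModType (scalars F k))
    (K : ptopologicalType)
    (R : K -> E -> G -> F) (S : H -> E -> G -> F)
    (K_compact : compact [set: K]) (K_hausdorff : hausdorff_space K)
    (R_ge0 : forall phi x b, 0 <= R phi x b)
    (S_ge0 : forall f x b, 0 <= S f x b)
    (RS0 : exists x0 : E, forall (phi : K) (b : G) (f : H),
       R phi x0 b = 0 /\ S f x0 b = 0)
    (R_continuous : forall (x : E) (b : G),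
       continuous (fun phi : K => R phi x b))
    (RS_scale : forall (phi : K) (x : E) (eta : F) (b : G) (f : H),
       0 <= eta <= 1 ->
       R phi x (real_scalar k eta *: b) <= eta * R phi x b /\
       eta * S f x b <= S f x (real_scalar k eta *: b))
    (p : F) (p_gt0 : 0 < p) (f : H) :
  (abstract_summing R S p f <-> exists C : F, domination_const R S p f C) /\
  (abstract_summing R S p f ->
   inf [set C | domination_const R S p f C] = pi_RS R S p f `^ p^-1).
Proof.
pose summing_dom := summing_domination K_compact K_hausdorff R_ge0 S_ge0
  R_continuous RS_scale p_gt0 (f := f).
pose dom_summing := domination_summing R_ge0 S_ge0 R_continuous p_gt0 (f := f).
split=> [|[C0 sC0]].
  split=> [[C1 sC1]|[C dC]].
    by exists (C1 `^ p^-1); exact: summing_dom.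
  by exists (C `^ p); exact: dom_summing.
have pos_lb (A : set F) : (forall c, A c -> 0 < c) -> has_lbound A.
  by move=> A0; exists 0 => c /A0/ltW.
set D := [set C | _].
have D_lb : has_lbound D by apply: pos_lb => c [].
have D0 : D !=set0 by exists (C0 `^ p^-1); exact: summing_dom.
have infD0 : 0 <= inf D by apply: lb_le_inf => // c [/ltW].
have pi_lb : has_lbound [set C1 | summing_const R S p f C1].
  by apply: pos_lb => c [].
have pi0 : 0 <= pi_RS R S p f.
  by apply: lb_le_inf; [exists C0|move=> c [/ltW]].
have p0 := ltW p_gt0.
have pV0 : 0 <= p^-1 by rewrite invr_ge0.
have powK c : 0 <= c -> (c `^ p) `^ p^-1 = c.
  by move=> c0; rewrite -powRrM mulfV ?gt_eqF// powRr1.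
have powVK c : 0 <= c -> (c `^ p^-1) `^ p = c.
  by move=> c0; rewrite -powRrM mulVf ?gt_eqF// powRr1.
apply/eqP; rewrite eq_le; apply/andP; split; last first.
  apply: lb_le_inf => // C dC.
  have C_ge0 : 0 <= C by exact: ltW dC.1.
  rewrite -[leRHS]powK//; apply: ge0_ler_powR; rewrite ?nnegrE ?powR_ge0//.
  by apply: ge_inf => //; exact: dom_summing.
rewrite -[leLHS]powK//; apply: ge0_ler_powR; rewrite ?nnegrE ?powR_ge0//.
apply: lb_le_inf => [|C1 sC1]; first by exists C0.
have C1_ge0 : 0 <= C1 by exact: ltW sC1.1.
rewrite -[leRHS]powVK//; apply: ge0_ler_powR; rewrite ?nnegrE ?powR_ge0//.
by apply: ge_inf => //; exact: summing_dom.
Qed.
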